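(* Let $\Omega$ be the ring of polyadic integers, let $A\subset\mathbb{N}$ be an infinite CD-set, and let $\Omega_A$ be the ring obtained as the completion of $\mathbb{N}$ with respect to the generalized polyadic norm $\|\cdot\|_A$. Let $\alpha\in\Omega$ be an element with $\bigcap_{a\in A} a\Omega=\alpha\Omega$. Then the ring $\Omega_A$ is isomorphic with the factor ring $\Omega/\alpha\Omega$.
   Context: $\mathbb{N}$ is the set of positive integers. A subset $A\subset\mathbb{N}$ is closed to divisibility (a CD-set) if: $1\in A$; whenever $m\in A$ and $d\mid m$ then $d\in A$; and whenever $m_1,m_2\in A$ then the least common multiple $[m_1,m_2]\in A$. Let $A$ be an infinite CD-set and let $\{B_n\}$ be a sequence of elements of $A$ such that for every $d\in A$ there exists $n_0$ with $d\mid B_n$ for all $n>n_0$. The generalized polyadic norm is $\|a\|_A=\sum_{n=1}^\infty \frac{h_n(a)}{2^n}$, where $h_n(a)=0$ if $B_n\mid a$ and $h_n(a)=1$ otherwise; here $a$ may be any integer, so that the associated metric on $\mathbb{N}$ is $(a,b)\mapsto\|a-b\|_A$. The completion $\Omega_A$ of $\mathbb{N}$ with respect to this metric, with addition and multiplication extended by continuity, is the ring of generalized polyadic integers. For $A=\mathbb{N}$ and $B_n=n!$ the norm $\|\cdot\|_{\mathbb{N}}$ is the polyadic norm and the completion, denoted $\Omega$, is the ring of polyadic integers. For $\beta\in\Omega$, $\beta\Omega=\{\beta\omega:\omega\in\Omega\}$ is the principal ideal generated by $\beta$. An element $\alpha$ with $\bigcap_{a\in A}a\Omega=\alpha\Omega$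 exists because every closed ideal of $\Omega$ is principal. *)

(* Defs.v *)
From HB Require Import structures.
From mathcomp Require Import all_boot all_order all_algebra generic_quotient.
From mathcomp Require Import ring_quotient zify ring.
From mathcomp Require Import all_classical all_reals all_analysis.

Set Implicit Arguments.
Unset Strict Implicit.
Unset Printing Implicit Defensive.

Import Order.TTheory GRing.Theory Num.Theory.
Import numFieldNormedType.Exports.

Local Open Scope classical_set_scope.
Local Open Scope ring_scope.
Local Open Scope quotient_scope.

Record cauchy_seq (R : realType) (M : metricType R) := CauchySeq {
  cauchy_val :> nat -> M;
  _ : `[< cauchy (cauchy_val @ \oo) >] }.

HB.instance Definition _ (R : realType) (M : metricType R) :=
  [isSub for @cauchy_val R M].
HB.instance Definition _ (R : realType) (M : metricType R) :=
  [Choice of cauchy_seq M by <:].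

Lemma cvg_ler (R : realType) (u v : nat -> R) (k l : R) :
  u @ \oo --> k -> v @ \oo --> l -> (forall n, u n <= v n) -> k <= l.
Proof.
move=> uk vl uv; rewrite -(cvg_lim _ uk)// -(cvg_lim _ vl)//.
apply: ler_lim; [exact: cvgP uk|exact: cvgP vl|exact: nearW].
Qed.

Section Completion.
Context {R : realType} {M : metricType R}.
Implicit Types (u v : nat -> M) (a b c : cauchy_seq M).

Lemma cauchy_seqE u : cauchy (u @ \oo) <->
  forall e : R, 0 < e -> exists N, forall m n, (N <= m)%N -> (N <= n)%N ->
    mdist (u m) (u n) < e.
Proof.
rewrite -cauchy_ballP; split => h e e0.
  have /= [[P Q] [[N1 _ hP] [N2 _ hQ]] H] := h e e0.
  exists (maxn N1 N2) => m n; rewrite !geq_max => /andP[m1 _] /andP[_ n2].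
  have := H (u m, u n); rewrite /= ballEmdist; apply; split.
    exact: hP.
  exact: hQ.
have [N hN] := h e e0.
exists ([set x | exists2 m, (N <= m)%N & x = u m],
        [set x | exists2 m, (N <= m)%N & x = u m]).
  by split; exists N => // m /= ?; exists m.
by move=> [x y] [/= [m ? ->] [n ? ->]]; rewrite ballEmdist; exact: hN.
Qed.

Lemma cauchy_valP a : cauchy (a @ \oo).
Proof. by apply/asboolP; case: a. Qed.

Lemma mdist_diff (x y x' y' : M) :
  `|mdist x y - mdist x' y'| <= mdist x x' + mdist y y'.
Proof.
have h (p q p' q' : M) : mdist p q - mdist p' q' <= mdist p p' + mdist q q'.
  rewrite lerBlDl addrA.
  apply: (le_trans (metric_triangle p q' q)); rewrite (metric_sym q' q) lerD2r.
  by rewrite addrC; exact: metric_triangle.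
rewrite ler_norml h andbT lerNl opprB (le_trans (h _ _ _ _))//.
by rewrite (metric_sym x') (metric_sym y').
Qed.

Lemma is_cvg_mdist_seq a b : cvgn (fun n => mdist (a n) (b n)).
Proof.
apply/cauchy_cvgP/cauchy_ballP => e e0.
have [N1 h1] := (cauchy_seqE _).1 (cauchy_valP a) _ (divr_gt0 e0 (ltr0n _ 2)).
have [N2 h2] := (cauchy_seqE _).1 (cauchy_valP b) _ (divr_gt0 e0 (ltr0n _ 2)).
pose S := [set x | exists2 m, (maxn N1 N2 <= m)%N & x = mdist (a m) (b m)].
exists (S, S).
  by split; exists (maxn N1 N2) => // m /= ?; exists m.
move=> [x y] [/= [m + ->] [n + ->]]; rewrite !geq_max.
move=> /andP[? ?] /andP[? ?]; rewrite /ball/= (le_lt_trans (mdist_diff _ _ _ _))//.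
by rewrite [e]splitr ltrD ?h1 ?h2.
Qed.

Definition cauchy_dist a b : R := limn (fun n => mdist (a n) (b n)).

Lemma cvg_cauchy_dist a b :
  (fun n => mdist (a n) (b n)) @ \oo --> cauchy_dist a b.
Proof. exact: is_cvg_mdist_seq. Qed.

Lemma cauchy_distxx a : cauchy_dist a a = 0.
Proof.
rewrite /cauchy_dist; under eq_fun do rewrite mdistxx.
exact: lim_cst.
Qed.

Lemma cauchy_dist_sym a b : cauchy_dist a b = cauchy_dist b a.
Proof. by rewrite /cauchy_dist; under eq_fun do rewrite metric_sym. Qed.

Lemma cauchy_dist_triangle b a c :
  cauchy_dist a c <= cauchy_dist a b + cauchy_dist b c.
Proof.
apply: cvg_ler; [exact: cvg_cauchy_dist|apply: cvgD; exact: cvg_cauchy_dist|].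
by move=> n; exact: metric_triangle.
Qed.

Lemma cauchy_dist_ge0 a b : 0 <= cauchy_dist a b.
Proof.
apply: limr_ge; first exact: is_cvg_mdist_seq.
by apply: nearW => n; exact: mdist_ge0.
Qed.

Definition cauchy_equiv a b : bool :=
  `[< (fun n => mdist (a n) (b n)) @ \oo --> (0 : R) >].

Lemma cauchy_equivE a b : cauchy_equiv a b = (cauchy_dist a b == 0).
Proof.
apply/asboolP/eqP => [/cvg_lim|<-]; first exact.
exact: cvg_cauchy_dist.
Qed.

Lemma cauchy_equiv_is_equiv : equiv_class_of cauchy_equiv.
Proof.
split=> [a|a b|b a c].
- by rewrite cauchy_equivE cauchy_distxx.
- by rewrite !cauchy_equivE cauchy_dist_sym.
rewrite !cauchy_equivE => /eqP ab /eqP bc.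
by rewrite eq_le cauchy_dist_ge0 andbT (le_trans (cauchy_dist_triangle b _ _))// ab bc addr0.
Qed.

Canonical cauchy_equiv_equiv := EquivRelPack cauchy_equiv_is_equiv.
Canonical cauchy_equiv_encModRel := defaultEncModRel cauchy_equiv.

End Completion.

Definition completion (R : realType) (M : metricType R) : Type :=
  {eq_quot (@cauchy_equiv R M)}.

HB.instance Definition _ (R : realType) (M : metricType R) :=
  Choice.on (completion M).
HB.instance Definition _ (R : realType) (M : metricType R) :
  EqQuotient (cauchy_seq M) (@cauchy_equiv R M) (completion M) :=
  EqQuotient.on (completion M).

Section CompletionMetric.
Context {R : realType} {M : metricType R}.
Implicit Types (a b : cauchy_seq M) (x y z : completion M).

Definition completion_dist x y : R := cauchy_dist (repr x) (repr y).

Lemma cauchy_dist_equiv a b a' b' : cauchy_equiv a a' -> cauchy_equiv b b' ->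
  cauchy_dist a b = cauchy_dist a' b'.
Proof.
rewrite !cauchy_equivE => /eqP aa /eqP bb.
apply/eqP; rewrite eq_le; apply/andP; split.
  rewrite (le_trans (cauchy_dist_triangle a' _ _))// aa add0r.
  by rewrite (le_trans (cauchy_dist_triangle b' _ _))// (cauchy_dist_sym b') bb addr0.
rewrite (le_trans (cauchy_dist_triangle a _ _))// cauchy_dist_sym aa add0r.
by rewrite (le_trans (cauchy_dist_triangle b _ _))// bb addr0.
Qed.

Lemma completion_eqP a b :
  reflect (\pi_(completion M) a = \pi_(completion M) b) (cauchy_equiv a b).
Proof. by apply: (iffP idP) => [h|/eqmodP]; [apply/eqmodP|]. Qed.

Lemma completion_distE a b : completion_dist (\pi_(completion M) a) (\pi_(completion M) b) = cauchy_dist a b.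
Proof.
by apply: cauchy_dist_equiv; apply/completion_eqP; rewrite reprK.
Qed.

Lemma completion_distxx x : completion_dist x x = 0.
Proof. exact: cauchy_distxx. Qed.

Lemma completion_dist_positivity x y : completion_dist x y = 0 -> x = y.
Proof.
move=> /eqP; rewrite -cauchy_equivE => /completion_eqP.
by rewrite !reprK.
Qed.

Lemma completion_dist_sym x y : completion_dist x y = completion_dist y x.
Proof. exact: cauchy_dist_sym. Qed.

Lemma completion_dist_triangle y x z :
  completion_dist x z <= completion_dist x y + completion_dist y z.
Proof. exact: cauchy_dist_triangle. Qed.

HB.instance Definition _ := isMetric.Build R (completion M)
  completion_distxx completion_dist_positivity completion_dist_sym
  completion_dist_triangle.

Lemma cauchy_cst (m : M) : `[< cauchy ((fun=> m) @ \oo) >].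
Proof.
apply/asboolP/cauchy_seqE => e e0; exists 0%N => *.
by rewrite mdistxx.
Qed.

Definition to_completion (m : M) : completion M := \pi_(completion M) (CauchySeq (cauchy_cst m)).

Lemma to_completion_isometry (m n : M) :
  mdist (to_completion m) (to_completion n) = mdist m n.
Proof. rewrite [LHS]completion_distE; apply: cvg_lim => //=; exact: cvg_cst. Qed.

Lemma mdist_to_completion a (e : R) : 0 < e ->
  exists N, forall n, (N <= n)%N -> mdist (\pi_(completion M) a) (to_completion (a n)) <= e.
Proof.
move=> e0; have [N hN] := (cauchy_seqE _).1 (cauchy_valP a) e e0.
exists N => n Nn; rewrite [leLHS]completion_distE.
apply: limr_le; first exact: is_cvg_mdist_seq.
by exists N => // m /= Nm; rewrite ltW// hN.
Qed.

Lemma to_completion_dense x (e : R) : 0 < e ->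
  exists m : M, mdist x (to_completion m) < e.
Proof.
move=> e0; rewrite -[x]reprK.
have [N /(_ N (leqnn _)) h] := mdist_to_completion (repr x) (divr_gt0 e0 (ltr0n _ 2)).
exists (repr x N); rewrite (le_lt_trans h)//.
by rewrite ltr_pdivrMr// ltr_pMr// ltr1n.
Qed.

Lemma completion_complete (F : set_system (completion M)) :
  ProperFilter F -> cauchy F -> exists x, F --> x.
Proof.
move=> FF /cauchyP Fc.
have H n : exists m : M, F (ball (to_completion m) (n.+1%:R^-1 *+ 2)).
  have e0 : 0 < n.+1%:R^-1 :> R by rewrite invr_gt0.
  have [x Fx] := Fc _ e0; have [m xm] := to_completion_dense x e0.
  exists m; apply: filterS Fx => y.
  rewrite !ballEmdist /= => xy.
  rewrite mulr2n (le_lt_trans (metric_triangle _ x _))// ltrD//.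
  by rewrite metric_sym.
have [m hm] := choice H.
have mm k l : mdist (m k) (m l) <= k.+1%:R^-1 *+ 2 + l.+1%:R^-1 *+ 2.
  have := filter_ex (filterI (hm k) (hm l)).
  move=> [y []]; rewrite !ballEmdist /= => ky ly.
  rewrite -to_completion_isometry (le_trans (metric_triangle _ y _))//.
  by rewrite lerD// ltW// metric_sym.
have small (e : R) : 0 < e -> exists N, forall k, (N <= k)%N ->
    k.+1%:R^-1 *+ 2 < e.
  move=> e0; have := near_infty_natSinv_lt (PosNum (divr_gt0 e0 (ltr0n R 2))).
  move=> [N _ hN]; exists N => k Nk; rewrite -[_ *+ 2]mulr_natr -ltr_pdivlMr//.
  exact: hN.
have mc : `[< cauchy (m @ \oo) >].
  apply/asboolP/cauchy_seqE => e e0.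
  have [N hN] := small _ (divr_gt0 e0 (ltr0n _ 2)).
  exists N => k l Nk Nl; rewrite (le_lt_trans (mm _ _))// [e]splitr.
  by rewrite ltrD ?hN.
exists (\pi_(completion M) (CauchySeq mc)).
apply/metricType_numDomainType.fcvgrPdist_lt => e e0.
have [N1 h1] := mdist_to_completion (CauchySeq mc) (divr_gt0 e0 (ltr0n _ 2)).
have [N2 h2] := small _ (divr_gt0 e0 (ltr0n _ 2)).
pose k := maxn N1 N2; apply: filterS (hm k) => y; rewrite ballEmdist /= => ky.
rewrite (le_lt_trans (metric_triangle _ (to_completion (m k)) _))// [e]splitr.
rewrite ler_ltD ?h1 ?leq_maxl// (lt_trans ky)// h2 ?leq_maxr//.
Qed.

End CompletionMetric.

(* An operation on [M] that does not expand distances is uniformly continuous,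
   hence has a unique continuous extension to the completion. *)
Section Extension.
Context {R : realType} {M : metricType R}.
Variable op : M -> M -> M.
Definition nonexpansive2 := forall x y x' y',
  mdist (op x y) (op x' y') <= mdist x x' + mdist y y'.
Hypothesis op_ne : nonexpansive2.

Lemma cauchy_op (a b : cauchy_seq M) :
  `[< cauchy ((fun n => op (a n) (b n)) @ \oo) >].
Proof.
apply/asboolP/cauchy_seqE => e e0.
have [N1 h1] := (cauchy_seqE _).1 (cauchy_valP a) _ (divr_gt0 e0 (ltr0n _ 2)).
have [N2 h2] := (cauchy_seqE _).1 (cauchy_valP b) _ (divr_gt0 e0 (ltr0n _ 2)).
exists (maxn N1 N2) => m n; rewrite !geq_max => /andP[? ?] /andP[? ?].
by rewrite (le_lt_trans (op_ne _ _ _ _))// [e]splitr ltrD ?h1 ?h2.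
Qed.

Definition cauchy_map2 (a b : cauchy_seq M) : cauchy_seq M :=
  CauchySeq (cauchy_op a b).

Lemma cauchy_map2_ne a b a' b' :
  cauchy_dist (cauchy_map2 a b) (cauchy_map2 a' b') <=
  cauchy_dist a a' + cauchy_dist b b'.
Proof.
apply: cvg_ler; [exact: cvg_cauchy_dist|apply: cvgD; exact: cvg_cauchy_dist|].
by move=> n; exact: op_ne.
Qed.

Definition extend2 (x y : completion M) : completion M :=
  \pi_(completion M) (cauchy_map2 (repr x) (repr y)).

Lemma extend2_ne x y x' y' :
  mdist (extend2 x y) (extend2 x' y') <= mdist x x' + mdist y y'.
Proof. by rewrite [leLHS]completion_distE; exact: cauchy_map2_ne. Qed.

Lemma extend2_continuous :
  continuous (fun p : completion M * completion M => extend2 p.1 p.2).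
Proof.
move=> [x y]; apply/metricType_numDomainType.cvgrPdist_lt => e e0.
exists (ball x (e / 2), ball y (e / 2)) => /=.
  by split; apply: nbhsx_ballx; rewrite divr_gt0.
move=> [x' y'] /= []; rewrite !ballEmdist /= => xx yy.
by rewrite (le_lt_trans (extend2_ne _ _ _ _))// [e]splitr ltrD.
Qed.

Lemma extend2_pi (a b : cauchy_seq M) :
  extend2 (\pi_(completion M) a) (\pi_(completion M) b) = \pi_(completion M) (cauchy_map2 a b).
Proof.
apply: mdist_positivity; apply/eqP; rewrite eq_le mdist_ge0 andbT.
rewrite [leLHS]completion_distE (le_trans (cauchy_map2_ne _ _ _ _))//.
by rewrite -!completion_distE !reprK !completion_distxx addr0.
Qed.

Lemma extend2_to_completion (m n : M) :
  extend2 (to_completion m) (to_completion n) = to_completion (op m n).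
Proof.
by rewrite extend2_pi; apply/completion_eqP; rewrite cauchy_equivE; apply/eqP;
   rewrite /cauchy_dist; under eq_fun do rewrite mdistxx; exact: lim_cst.
Qed.

End Extension.

Record posnat := PosNat { posnat_val :> nat; posnat_gt0 : (0 < posnat_val)%N }.

HB.instance Definition _ := [isSub for posnat_val].
HB.instance Definition _ := [Countable of posnat by <:].

Definition pone : posnat := PosNat (ltn0Sn 0).

Fact padd_subproof (m n : posnat) : (0 < m + n)%N.
Proof. by rewrite addn_gt0 posnat_gt0. Qed.
Definition padd (m n : posnat) : posnat := PosNat (padd_subproof m n).

Fact pmul_subproof (m n : posnat) : (0 < m * n)%N.
Proof. by rewrite muln_gt0 !posnat_gt0. Qed.
Definition pmul (m n : posnat) : posnat := PosNat (pmul_subproof m n).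

Fact plcm_subproof (m n : posnat) : (0 < lcmn m n)%N.
Proof. by rewrite lcmn_gt0 !posnat_gt0. Qed.
Definition plcm (m n : posnat) : posnat := PosNat (plcm_subproof m n).

Definition pfact (n : nat) : posnat := PosNat (fact_gt0 n).

Definition cd_set (A : set posnat) : Prop :=
  [/\ A pone,
      forall m d : posnat, A m -> (d %| m)%N -> A d &
      forall m1 m2 : posnat, A m1 -> A m2 -> A (plcm m1 m2)].

(* Sequences are indexed by the positive integers: [B 0] is never used. *)
Definition cofinal_seq (A : set posnat) (B : nat -> posnat) : Prop :=
  (forall n, (0 < n)%N -> A (B n)) /\
  (forall d : posnat, A d -> exists n0, forall n, (n0 < n)%N -> (d %| B n)%N).

Definition polyadic_h (B : nat -> posnat) (n : nat) (a : int) : nat :=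
  if ((B n : nat)%:Z %| a)%Z then 0 else 1.

Definition polyadic_norm (R : realType) (B : nat -> posnat) (a : int) : R :=
  limn (fun N => \sum_(1 <= n < N) (polyadic_h B n a)%:R / 2 ^+ n : R).

Section Norm.
Context {R : realType}.
Variables (A : set posnat) (B : nat -> posnat).
Hypotheses (infA : infinite_set A) (AB : cofinal_seq A B).
Implicit Types (a b c : int) (x y z : posnat).
Local Notation norm := (@polyadic_norm R B).
Local Notation h := (polyadic_h B).
Let S a N : R := \sum_(1 <= n < N) (h n a)%:R / 2 ^+ n.

Lemma polyadic_h_le1 n a : (h n a <= 1)%N.
Proof. by rewrite /polyadic_h; case: ifP. Qed.

Lemma sum_half_pow N m : (m <= N)%N ->
  \sum_(m <= n < N) (2 ^+ n.+1)^-1 = (2 ^+ m)^-1 - (2 ^+ N)^-1 :> R.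
Proof.
move=> mN; rewrite (telescope_sumr_eq (fun n => - (2 ^+ n)^-1))//.
  by rewrite opprK addrC.
by move=> k _; rewrite exprS; field; rewrite expf_neq0.
Qed.

Lemma polyadic_term_ge0 n a : 0 <= (h n a)%:R / 2 ^+ n :> R.
Proof. by rewrite divr_ge0// exprn_ge0. Qed.

Lemma polyadic_sum_tail N a m : (forall n, (0 < n <= m)%N -> h n a = 0%N) ->
  S a N <= (2 ^+ m)^-1.
Proof.
move=> h0; have [Nm|mN] := leqP N m.+1.
  rewrite /S big_nat_cond big1 ?invr_ge0 ?exprn_ge0// => n /andP[/andP[n0 nN] _].
  by rewrite h0 ?mul0r// n0 -ltnS (leq_trans nN).
rewrite /S (@big_cat_nat _ _ _ m.+1)//=; last exact: ltnW.
rewrite big_nat_cond big1 ?add0r; last first.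
  by move=> n /andP[nn _]; rewrite h0 ?mul0r.
rewrite big_add1 (@le_trans _ _ (\sum_(m <= n < N.-1) (2 ^+ n.+1)^-1))//.
  apply: ler_sum => n _; rewrite ler_piMl ?invr_ge0 ?exprn_ge0//.
  by rewrite lern1 polyadic_h_le1.
rewrite sum_half_pow; last by rewrite -ltnS (ltn_predK mN) ltnW.
by rewrite lerBlDr lerDl invr_ge0 exprn_ge0.
Qed.

Lemma polyadic_sum_nondecreasing a : nondecreasing_seq (S a).
Proof.
move=> m n mn; rewrite /S; case: m mn => [|m] mn.
  by rewrite [leLHS]big_geq// sumr_ge0// => *; exact: polyadic_term_ge0.
by rewrite [leRHS](@big_cat_nat _ _ _ m.+1)//= lerDl sumr_ge0.
Qed.

Lemma is_cvg_polyadic a : cvgn (S a).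
Proof.
apply: nondecreasing_is_cvgn; first exact: polyadic_sum_nondecreasing.
exists 1 => _ [N _ <-]; have := @polyadic_sum_tail N a 0.
by rewrite expr0 invr1; apply => -[].
Qed.

Lemma cvg_polyadic a : S a @ \oo --> norm a.
Proof. exact: is_cvg_polyadic. Qed.

Lemma polyadic_norm_tail a m : (forall n, (0 < n <= m)%N -> h n a = 0%N) ->
  norm a <= (2 ^+ m)^-1.
Proof.
move=> h0; apply: limr_le; first exact: is_cvg_polyadic.
by apply: nearW => N; exact: polyadic_sum_tail.
Qed.

Lemma polyadic_norm_ge_term a n : (0 < n)%N -> (h n a)%:R / 2 ^+ n <= norm a.
Proof.
move=> n0; apply: limr_ge; first exact: is_cvg_polyadic.
exists n.+1 => // N /= nN.
rewrite (le_trans _ (polyadic_sum_nondecreasing a nN))// /S.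
by rewrite big_nat_recr//= lerDr sumr_ge0// => *; exact: polyadic_term_ge0.
Qed.

Lemma polyadic_norm_le2 a b c : (forall n, h n a <= h n b + h n c)%N ->
  norm a <= norm b + norm c.
Proof.
move=> abc; apply: cvg_ler.
- exact: cvg_polyadic.
- apply: cvgD; exact: cvg_polyadic.
move=> N; change (S a N <= S b N + S c N); rewrite /S -big_split ler_sum//= => n _.
by rewrite -mulrDl ler_pM2r ?invr_gt0 ?exprn_gt0// -natrD ler_nat.
Qed.

Lemma polyadic_norm0 : norm 0 = 0.
Proof.
rewrite /polyadic_norm (_ : (fun _ => _) = fun=> 0); last first.
  by apply/funext => N; rewrite big1// => n _; rewrite /polyadic_h dvdz0 mul0r.
by apply: cvg_lim => //; exact: cvg_cst.
Qed.

Lemma polyadic_normN a : norm (- a) = norm a.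
Proof.
rewrite /polyadic_norm; congr (limn _); apply/funext => N.
by apply: eq_bigr => n _; rewrite /polyadic_h rpredN.
Qed.

Lemma polyadic_norm_eq0 a : norm a = 0 -> a = 0.
Proof.
move=> a0; have dvda n : (0 < n)%N -> ((B n : nat)%:Z %| a)%Z.
  move=> n0; have := polyadic_norm_ge_term a n0; rewrite a0 /polyadic_h.
  case: ifP => // _; rewrite leNgt => /negP[].
  by rewrite mul1r invr_gt0 exprn_gt0.
have [d Ad ad] : exists2 d, A d & (absz a < d)%N.
  apply: contrapT => H; apply: infA.
  apply: (@sub_finite_set _ _ (posnat_val @^-1` `I_(absz a).+1)).
    move=> d Ad; rewrite /= ltnS leqNgt; apply/negP => ad; apply: H.
    by exists d.
  apply: finite_preimage; last exact: finite_II.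
  by move=> u v _ _; exact: val_inj.
have [n0 Hn0] := AB.2 d Ad.
have dB := Hn0 n0.+1 (ltnSn _); have Ba := dvda n0.+1 isT.
have : (d %| absz a)%N by rewrite (dvdn_trans dB).
by case: (posnP (absz a)) => [/eqP|a1 /(dvdn_leq a1)]; [rewrite absz_eq0 => /eqP|rewrite leqNgt ad].
Qed.

Lemma polyadic_cvg0 (u : nat -> int) :
  (forall n, (0 < n)%N ->
     exists K, forall k, (K <= k)%N -> ((B n : nat)%:Z %| u k)%Z) ->
  (fun k => norm (u k)) @ \oo --> (0 : R).
Proof.
move=> H; have HK m : exists K, forall k, (K <= k)%N ->
    forall n, (0 < n <= m)%N -> ((B n : nat)%:Z %| u k)%Z.
  elim: m => [|m [K1 h1]]; first by exists 0%N => k _ [].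
  have [K2 h2] := H m.+1 isT; exists (maxn K1 K2) => k.
  rewrite geq_max => /andP[k1 k2] n /andP[n0]; rewrite leq_eqVlt => /predU1P[->|nm].
    exact: h2.
  by apply: h1 => //; rewrite n0.
apply/cvgrPdist_le => e e0.
have [m hm] : exists m, (2 ^+ m)^-1 <= e.
  have /cvgrPdist_le/(_ e e0) [m _ hm] : (fun n => (2^-1 : R) ^+ n) @ \oo --> (0 : R).
    by apply: cvg_expr; rewrite ger0_norm ?invr_ge0// invf_lt1// ltr1n.
  exists m; have := hm m (leqnn m); rewrite sub0r normrN ger0_norm ?exprVn//.
have [K hK] := HK m; exists K => // k /= Kk.
rewrite sub0r normrN ger0_norm; last first.
  by rewrite (le_trans _ (polyadic_norm_ge_term _ (ltn0Sn 0)))// polyadic_term_ge0.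
apply: le_trans hm; apply: polyadic_norm_tail => n nm.
by rewrite /polyadic_h hK.
Qed.

Definition polyadic_dist x y : R := norm ((x : nat)%:Z - (y : nat)%:Z).

Lemma polyadic_distxx x : polyadic_dist x x = 0.
Proof. by rewrite /polyadic_dist subrr polyadic_norm0. Qed.

Lemma polyadic_dist_positivity x y : polyadic_dist x y = 0 -> x = y.
Proof.
move=> /polyadic_norm_eq0 /eqP; rewrite subr_eq0 => /eqP[xy].
exact: val_inj.
Qed.

Lemma polyadic_dist_sym x y : polyadic_dist x y = polyadic_dist y x.
Proof. by rewrite /polyadic_dist -polyadic_normN opprB. Qed.

Lemma polyadic_h_linear n a b c p q : a = p * b + q * c ->
  (h n a <= h n b + h n c)%N.
Proof.
move=> ->; rewrite /polyadic_h; case: (boolP (_ %| b)%Z) => bn; last first.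
  by case: ifP.
case: (boolP (_ %| c)%Z) => cn; last by case: ifP.
by rewrite rpredD ?dvdz_mull.
Qed.

Lemma polyadic_dist_triangle y x z :
  polyadic_dist x z <= polyadic_dist x y + polyadic_dist y z.
Proof.
apply: polyadic_norm_le2 => n; apply: (@polyadic_h_linear _ _ _ _ 1 1).
by rewrite !mul1r addrA subrK.
Qed.

End Norm.

Definition polyadic_nat (R : realType) (A : set posnat) (B : nat -> posnat)
  (infA : infinite_set A) (AB : cofinal_seq A B) : Type := posnat.

Section PolyadicIntegers.
Context (R : realType) (A : set posnat) (B : nat -> posnat).
Variables (infA : infinite_set A) (AB : cofinal_seq A B).
Local Notation PN := (polyadic_nat R infA AB).

HB.instance Definition _ := Choice.on PN.
HB.instance Definition _ := isMetric.Build R PN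
  (@polyadic_distxx R B) (polyadic_dist_positivity infA AB)
  (@polyadic_dist_sym R B) (@polyadic_dist_triangle R B).

Lemma padd_nonexpansive : nonexpansive2 (padd : PN -> PN -> PN).
Proof.
move=> x y x' y'; apply: polyadic_norm_le2 => n.
by apply: (@polyadic_h_linear _ _ _ _ _ 1 1); rewrite /= !PoszD; ring.
Qed.

Lemma pmul_nonexpansive : nonexpansive2 (pmul : PN -> PN -> PN).
Proof.
move=> x y x' y'; apply: polyadic_norm_le2 => n.
by apply: (@polyadic_h_linear _ _ _ _ _ (y : nat)%:Z (x' : nat)%:Z);
  rewrite /= !PoszM; ring.
Qed.

Definition generalized_polyadic : Type := completion PN.

HB.instance Definition _ := Metric.on generalized_polyadic.

Local Notation Om := generalized_polyadic.
Local Notation cls a := (\pi_(completion PN) a : Om).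

Definition polyadic_of_posnat (m : posnat) : Om := to_completion (m : PN).

Definition polyadic_add : Om -> Om -> Om := extend2 padd_nonexpansive.
Definition polyadic_mul : Om -> Om -> Om := extend2 pmul_nonexpansive.
Definition polyadic_one : Om := polyadic_of_posnat pone.

Lemma cofinal_dvd n : (0 < n)%N ->
  exists K, forall k, (K <= k)%N -> (B n %| B k)%N.
Proof. by move=> n0; have [n1 hn] := AB.2 _ (AB.1 n n0); exists n1.+1. Qed.

Lemma polyadic_norm_cofinal : (fun k => polyadic_norm R B (B k : nat)%:Z) @ \oo --> (0 : R).
Proof. by apply: polyadic_cvg0 => n /cofinal_dvd[K hK]; exists K. Qed.

Lemma cauchy_cofinal_mul (p : int) (u : nat -> PN) :
  (forall m n, ((u m : posnat) : nat)%:Z - ((u n : posnat) : nat)%:Z =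
     p * ((B m : nat)%:Z - (B n : nat)%:Z)) ->
  `[< cauchy (u @ \oo) >].
Proof.
move=> up; apply/asboolP/cauchy_seqE => e e0.
have [N _ hN] := (cvgrPdist_lt _ _).1 polyadic_norm_cofinal _ (divr_gt0 e0 (ltr0n _ 2)).
have {}hN k : (N <= k)%N -> polyadic_norm R B (B k : nat)%:Z < e / 2.
  move=> /hN /=; rewrite sub0r normrN; exact: le_lt_trans (ler_norm _).
exists N => m n Nm Nn.
rewrite (@le_lt_trans _ _ (polyadic_norm R B (B m : nat)%:Z + polyadic_norm R B (B n : nat)%:Z))//.
  apply: polyadic_norm_le2 => k.
  by apply: (@polyadic_h_linear _ _ _ _ _ p (- p)); rewrite up; ring.
by rewrite [e]splitr ltrD// hN.
Qed.

Lemma cauchy_cofinal : `[< cauchy ((B : nat -> PN) @ \oo) >].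
Proof. by apply: (@cauchy_cofinal_mul 1) => m n; rewrite mul1r. Qed.

(* Zero is not a positive integer: it is the limit of the sequence [B]. *)
Definition polyadic_zero : Om := cls (CauchySeq cauchy_cofinal).

Fact negone_subproof n : (0 < (B n).*2.-1)%N.
Proof. by have := posnat_gt0 (B n); case: (B n : nat) => // k _; rewrite doubleS. Qed.

Lemma cauchy_negone :
  `[< cauchy (((fun n => PosNat (negone_subproof n)) : nat -> PN) @ \oo) >].
Proof.
apply: (@cauchy_cofinal_mul 2) => m n /=.
have := posnat_gt0 (B m); have := posnat_gt0 (B n); lia.
Qed.

(* The integers [2 * B n - 1] are positive and converge to [-1]. *)
Definition polyadic_opp (x : Om) : Om :=
  polyadic_mul (cls (CauchySeq cauchy_negone)) x.

Lemma cls_ind (P : Om -> Prop) : (forall a, P (cls a)) -> forall x, P x.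
Proof. by move=> h x; rewrite -[x]reprK; exact: h. Qed.

Lemma polyadic_cls_eq (a b : cauchy_seq PN) :
  (forall n, (0 < n)%N -> exists K, forall k, (K <= k)%N ->
    ((B n : nat)%:Z %| ((a k : posnat) : nat)%:Z - ((b k : posnat) : nat)%:Z)%Z) ->
  cls a = cls b.
Proof. by move=> h; apply/completion_eqP/asboolP; exact: polyadic_cvg0. Qed.

Lemma polyadic_cls_ext (a b : cauchy_seq PN) :
  (forall k, ((a k : posnat) : nat) = ((b k : posnat) : nat)) -> cls a = cls b.
Proof.
move=> h; apply: polyadic_cls_eq => n n0; exists 0%N => k _.
by rewrite h subrr dvdz0.
Qed.

Lemma polyadic_addE a b :
  polyadic_add (cls a) (cls b) = cls (cauchy_map2 padd_nonexpansive a b).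
Proof. exact: extend2_pi. Qed.

Lemma polyadic_mulE a b :
  polyadic_mul (cls a) (cls b) = cls (cauchy_map2 pmul_nonexpansive a b).
Proof. exact: extend2_pi. Qed.

Lemma polyadic_addA : associative polyadic_add.
Proof.
elim/cls_ind=> a; elim/cls_ind=> b; elim/cls_ind=> c; rewrite !polyadic_addE.
by apply: polyadic_cls_ext => k /=; rewrite addnA.
Qed.

Lemma polyadic_addC : commutative polyadic_add.
Proof.
elim/cls_ind=> a; elim/cls_ind=> b; rewrite !polyadic_addE.
by apply: polyadic_cls_ext => k /=; rewrite addnC.
Qed.

Lemma polyadic_add0 : left_id polyadic_zero polyadic_add.
Proof.
elim/cls_ind=> a; rewrite !polyadic_addE; apply: polyadic_cls_eq => n.
move=> /cofinal_dvd[K hK]; exists K => k /hK /=.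
by rewrite PoszD addrK.
Qed.

Lemma polyadic_addN : left_inverse polyadic_zero polyadic_opp polyadic_add.
Proof.
elim/cls_ind=> a; rewrite /polyadic_opp polyadic_mulE polyadic_addE.
apply: polyadic_cls_eq => n /cofinal_dvd[K hK]; exists K => k /hK /= nk.
have -> : ((B k).*2.-1 * (a k : posnat) + (a k : posnat))%N%:Z - (B k : nat)%:Z =
    (((a k : posnat) : nat)%:Z *+ 2 - 1) * (B k : nat)%:Z.
  by have := posnat_gt0 (B k); case: (B k : nat) => // m _; rewrite doubleS /=; lia.
exact: dvdz_mull.
Qed.

HB.instance Definition _ := GRing.isZmodule.Build Om
  polyadic_addA polyadic_addC polyadic_add0 polyadic_addN.

Lemma polyadic_mulA : associative polyadic_mul.
Proof.
elim/cls_ind=> a; elim/cls_ind=> b; elim/cls_ind=> c; rewrite !polyadic_mulE.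
by apply: polyadic_cls_ext => k /=; rewrite mulnA.
Qed.

Lemma polyadic_mulC : commutative polyadic_mul.
Proof.
elim/cls_ind=> a; elim/cls_ind=> b; rewrite !polyadic_mulE.
by apply: polyadic_cls_ext => k /=; rewrite mulnC.
Qed.

Lemma polyadic_mul1 : left_id polyadic_one polyadic_mul.
Proof.
elim/cls_ind=> a; rewrite [LHS]polyadic_mulE; apply: polyadic_cls_ext => k /=.
by rewrite mul1n.
Qed.

Lemma polyadic_mulDl : left_distributive polyadic_mul +%R.
Proof.
elim/cls_ind=> a; elim/cls_ind=> b; elim/cls_ind=> c.
change (polyadic_mul (polyadic_add (cls a) (cls b)) (cls c) =
  polyadic_add (polyadic_mul (cls a) (cls c)) (polyadic_mul (cls b) (cls c))).
rewrite polyadic_addE !polyadic_mulE polyadic_addE.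
by apply: polyadic_cls_ext => k /=; rewrite mulnDl.
Qed.

HB.instance Definition _ := GRing.Zmodule_isComPzRing.Build Om
  polyadic_mulA polyadic_mulC polyadic_mul1 polyadic_mulDl.

Lemma polyadic_addr_continuous : continuous (fun p : Om * Om => p.1 + p.2).
Proof. exact: extend2_continuous. Qed.

Lemma polyadic_mulr_continuous : continuous (fun p : Om * Om => p.1 * p.2).
Proof. exact: extend2_continuous. Qed.

Lemma polyadic_of_posnatD m n :
  polyadic_of_posnat (padd m n) = polyadic_of_posnat m + polyadic_of_posnat n.
Proof. by rewrite [RHS]extend2_to_completion. Qed.

Lemma polyadic_of_posnatM m n :
  polyadic_of_posnat (pmul m n) = polyadic_of_posnat m * polyadic_of_posnat n.
Proof. by rewrite [RHS]extend2_to_completion. Qed.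

End PolyadicIntegers.

Lemma cd_setT : cd_set [set: posnat].
Proof. by []. Qed.

Lemma infinite_posnat : infinite_set [set: posnat].
Proof.
move=> /(finite_image posnat_val) fin; apply: infinite_nat.
apply: (@sub_finite_set _ _ (succn @^-1` (posnat_val @` [set: posnat]))).
  by move=> n _; exists (PosNat (ltn0Sn n)).
by apply: finite_preimage fin => m n _ _ [].
Qed.

Lemma cofinal_fact : cofinal_seq [set: posnat] pfact.
Proof.
split=> // d _; exists (posnat_val d) => n dn.
by rewrite /= dvdn_fact// posnat_gt0 ltnW.
Qed.

Definition polyadic_integers (R : realType) : Type :=
  generalized_polyadic R infinite_posnat cofinal_fact.

HB.instance Definition _ (R : realType) :=
  GRing.ComPzRing.on (polyadic_integers R).

Definition to_polyadic_integers (R : realType) (a : posnat) :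
  polyadic_integers R := polyadic_of_posnat R infinite_posnat cofinal_fact a.

Definition principal_ideal (S : comPzRingType) (b : S) : set S :=
  [set b * w | w in [set: S]].

Section FactorRing.
Variables (S : comPzRingType) (b : S).

Definition in_principal_ideal : {pred S} := [pred x | x \in principal_ideal b].

Lemma in_principal_idealP x :
  reflect (principal_ideal b x) (x \in in_principal_ideal).
Proof. by rewrite inE; apply: (iffP idP); rewrite inE. Qed.

Lemma principal_ideal_zmod : zmod_closed in_principal_ideal.
Proof.
split=> [|x y]; first by apply/in_principal_idealP; exists 0; rewrite ?mulr0.
move=> /in_principal_idealP[v _ <-] /in_principal_idealP[w _ <-].
by apply/in_principal_idealP; exists (v - w); rewrite ?mulrBr.
Qed.

HB.instance Definition _ :=
  GRing.isZmodClosed.Build S in_principal_ideal principal_ideal_zmod.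

(* The quotient ring structure of the library is restricted to proper ideals,
   so only its additive quotient is reused. *)
Definition factor_ring : Type := Quotient.quot in_principal_ideal.

HB.instance Definition _ := GRing.Zmodule.on factor_ring.

Local Notation Q := factor_ring.
Local Notation cls x := (\pi_(Quotient.quot in_principal_ideal) x : Q).

Definition factor_one : Q := cls 1.
Definition factor_mul (x y : Q) : Q :=
  cls (repr (x : Quotient.quot in_principal_ideal) *
       repr (y : Quotient.quot in_principal_ideal)).

Lemma factor_eqP (x y : S) : reflect (cls x = cls y) (x - y \in in_principal_ideal).
Proof. by rewrite Quotient.idealrBE; exact: eqP. Qed.

Lemma factor_ind (P : Q -> Prop) : (forall x, P (cls x)) -> forall x, P x.
Proof.
by move=> h x; rewrite -[x](@reprK _ (Quotient.quot in_principal_ideal)); exact: h.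
Qed.

Lemma factor_mulE x y : factor_mul (cls x) (cls y) = cls (x * y).
Proof.
apply/factor_eqP; set x' := repr _; set y' := repr _.
have /factor_eqP/in_principal_idealP[v _ vx] : cls x' = cls x by rewrite reprK.
have /factor_eqP/in_principal_idealP[w _ wy] : cls y' = cls y by rewrite reprK.
apply/in_principal_idealP; exists (v * y' + x * w) => //.
by rewrite mulrDr mulrA vx mulrCA wy; ring.
Qed.

Lemma factor_addE x y : cls x + cls y = cls (x + y).
Proof. by rewrite [RHS]raddfD. Qed.

Lemma factor_mulA : associative factor_mul.
Proof.
elim/factor_ind=> x; elim/factor_ind=> y; elim/factor_ind=> z.
by rewrite !factor_mulE mulrA.
Qed.

Lemma factor_mulC : commutative factor_mul.
Proof.
by elim/factor_ind=> x; elim/factor_ind=> y; rewrite !factor_mulE mulrC.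
Qed.

Lemma factor_mul1 : left_id factor_one factor_mul.
Proof. by elim/factor_ind=> x; rewrite factor_mulE mul1r. Qed.

Lemma factor_mulDl : left_distributive factor_mul +%R.
Proof.
elim/factor_ind=> x; elim/factor_ind=> y; elim/factor_ind=> z.
by rewrite factor_addE !factor_mulE factor_addE mulrDl.
Qed.

HB.instance Definition _ := GRing.Zmodule_isComPzRing.Build Q
  factor_mulA factor_mulC factor_mul1 factor_mulDl.

End FactorRing.

(* Main.v *)
Require Import Defs.
From HB Require Import structures.
From mathcomp Require Import all_boot all_order all_algebra generic_quotient.
From mathcomp Require Import ring.
From mathcomp Require Import all_classical all_reals all_analysis.

(** The metric only sees congruences modulo the elements of [A]: a sequence of
positive integers is Cauchy for [||.||_A] exactly when, for each [d] in [A], it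
is eventually constant modulo [d] ([cauchy_residue], [residue_cauchy]), and two
Cauchy sequences have the same limit exactly when, for each [d] in [A], they
are eventually congruent modulo [d] ([polyadic_cls_eqP]).  In other words,
Omega_A is the inverse limit of the rings Z/dZ over [A].

A polyadic Cauchy sequence is therefore Cauchy for [||.||_A], which gives a ring
morphism from Omega to Omega_A ([polyadic_restrict]).  An element of Omega, the
limit of a sequence [x], is sent to zero exactly when each [a] in [A] divides
[x k] for large [k].  This amounts to [a] dividing the limit in Omega, since
[x k / a] is then again a polyadic Cauchy sequence: the kernel is the intersection of the
ideals [a Omega], which is [alpha Omega] ([polyadic_restrict_eq0]).

The morphism is onto because a compatible system of residues modulo the
elements of [A] extends to all moduli ([lift_residues]): integers [x n] having
the prescribed residues modulo the divisors of [n!] in [A] are chosen in turn,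
with [x n.+1] congruent to [x n] modulo [n!], by the Chinese remainder theorem
for moduli that need not be coprime.  Both closure properties of [A] are used:
stability under lcm replaces the constraints modulo all divisors of [(n + 1)!] in
[A] by one constraint modulo the largest one, and stability under divisors
shows that this constraint is compatible with that modulo [n!].

The first isomorphism theorem ([factor_ring_iso]) concludes. *)

Import Order.TTheory GRing.Theory Num.Theory.
Import numFieldNormedType.Exports.

Set Implicit Arguments.
Unset Strict Implicit.
Unset Printing Implicit Defensive.

Local Open Scope classical_set_scope.
Local Open Scope ring_scope.

(** * First isomorphism theorem *)

Section FirstIsomorphism.
Variables (S T : comPzRingType) (b : S) (phi : {rmorphism S -> T}).
Hypothesis phi_surj : forall t, exists s, phi s = t.
Hypothesis phi_ker : forall s, phi s = 0 <-> principal_ideal b s.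
Local Notation Q := (Quotient.quot (in_principal_ideal b)).
Local Notation cls x := ((\pi_Q x)%qT : factor_ring b).

Lemma factor_cls_eqP s s' : cls s = cls s' <-> phi s = phi s'.
Proof.
split=> [/factor_eqP/in_principal_idealP/phi_ker|e].
  by rewrite rmorphB => /eqP; rewrite subr_eq0 => /eqP.
by apply/factor_eqP/in_principal_idealP/phi_ker; rewrite rmorphB e subrr.
Qed.

(** The isomorphism sends [t] to the class of a chosen preimage of [t]; its
inverse is the map induced by [phi] on classes. *)
Lemma factor_ring_iso : exists f : {rmorphism T -> factor_ring b}, bijective f.
Proof.
have [g gK] := choice phi_surj.
pose f t := cls (g t).
have f_nmod : nmod_morphism f.
  split=> [|t t'].
    have <- : cls 0 = 0 by exact: raddf0.
    by apply/factor_cls_eqP; rewrite gK rmorph0.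
  by rewrite /f factor_addE; apply/factor_cls_eqP; rewrite rmorphD !gK.
have f_monoid : monoid_morphism f.
  split=> [|t t'].
    change (cls (g 1) = cls 1).
    by apply/factor_cls_eqP; rewrite gK rmorph1.
  rewrite /f [RHS]factor_mulE; apply/factor_cls_eqP.
  by rewrite rmorphM !gK.
pose fA := GRing.isNmodMorphism.Build _ _ f f_nmod.
pose fM := GRing.isMonoidMorphism.Build _ _ f f_monoid.
pose F : {rmorphism T -> factor_ring b} := HB.pack f fA fM.
exists F; exists (fun q : factor_ring b => phi (repr (q : Q))) => [t|].
  by rewrite -[RHS]gK; apply/factor_cls_eqP; exact: (@reprK _ Q).
elim/factor_ind=> s; apply/factor_cls_eqP.
by rewrite gK; apply/factor_cls_eqP; exact: (@reprK _ Q).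
Qed.
End FirstIsomorphism.

(** * Congruences between positive integers *)

Local Notation "p ≡ q [ d ]" := (((d : posnat) : nat)%:Z %| p - q)%Z
  (at level 70, q at next level, format "p  ≡  q  [ d ]").
Local Notation "u %:zp" := (((u : posnat) : nat)%:Z) (at level 2, format "u %:zp").

Lemma eqmod_trans (d : posnat) (q p r : int) : p ≡ q [d] -> q ≡ r [d] -> p ≡ r [d].
Proof. by move=> pq qr; rewrite -(subrKA q) rpredD. Qed.

Lemma eqmod_sym (d : posnat) (p q : int) : p ≡ q [d] -> q ≡ p [d].
Proof. by rewrite -opprB rpredN. Qed.

Lemma eqmod_dvd (d e : posnat) (p q : int) : (e %| d)%N -> p ≡ q [d] -> p ≡ q [e].
Proof. by move=> ed; apply: dvdz_trans. Qed.

(** From a Bezout relation [u m + v n = gcd m n] and [p - q = c (gcd m n)], the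
integer [z = p - c u m = q + c v n] solves both congruences; adding a multiple
of [m n] makes it positive. *)
Lemma posnat_chinese (m n : posnat) (p q : int) :
  (gcdz m%:zp n%:zp %| p - q)%Z ->
  exists z : posnat, z%:zp ≡ p [m] /\ z%:zp ≡ q [n].
Proof.
have [u [v uv]] := Bezoutz m%:zp n%:zp.
move=> /dvdzP[c pq]; pose z := p - c * u * m%:zp.
(* The remainder may be zero, hence the extra [m n]. *)
pose w := (z %% (m%:zp * n%:zp))%Z + m%:zp * n%:zp.
have mn0 : 0 < m%:zp * n%:zp by rewrite mulr_gt0// ltz_nat posnat_gt0.
have w_gt0 : 0 < w by apply: ltr_wpDl; rewrite // modz_ge0// gt_eqF.
have w0 : (0 < `|w|)%N by rewrite absz_gt0 gt_eqF.
have wE : (PosNat w0)%:zp = z + (1 - (z %/ (m%:zp * n%:zp))%Z) * (m%:zp * n%:zp).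
  rewrite /= gez0_abs; last exact: ltW.
  by rewrite /w /modz; ring.
exists (PosNat w0); rewrite wE; split; apply/dvdzP.
  exists (- c * u + (1 - (z %/ (m%:zp * n%:zp))%Z) * n%:zp).
  by rewrite /z; ring.
exists (c * v + (1 - (z %/ (m%:zp * n%:zp))%Z) * m%:zp).
rewrite /z.
have -> : p = q + c * (u * m%:zp + v * n%:zp) by rewrite uv -pq; ring.
ring.
Qed.

(** A divisor of [m] in [A] of maximal size is a multiple of any other one [d],
because their lcm is again a divisor of [m] in [A], of size at least as big. *)
Lemma cd_set_greatest_divisor (A : set posnat) (m : posnat) : cd_set A ->
  exists g, [/\ A g, (g %| m)%N &
    forall d : posnat, A d -> (d %| m)%N -> (d %| g)%N].
Proof.
move=> [A1 _ Alcm].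
pose P i := (i %| m)%N && `[< exists2 d : posnat, A d & (d : nat) = i >].
have exP : exists i, P i.
  by exists 1%N; rewrite /P dvd1n; apply/asboolP; exists pone.
have leP i : P i -> (i <= m)%N.
  by move=> /andP[im _]; apply: dvdn_leq => //; exact: posnat_gt0.
case: (ex_maxnP exP leP) => i /andP[im /asboolP[g Ag gi]] imax.
rewrite -{i}gi in im imax.
exists g; split=> // d Ad dm.
have : (plcm d g <= g)%N.
  apply: imax; rewrite /P/= dvdn_lcm dm im.
  by apply/asboolP; exists (plcm d g) => //; exact: Alcm.
have gl : (g %| plcm d g)%N by rewrite /= dvdn_lcmr.
move=> lg; have /eqP -> : (g : nat) == plcm d g.
  by rewrite eqn_leq lg andbT dvdn_leq// posnat_gt0.
exact: dvdn_lcml.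
Qed.

(** A compatible system [r] of residues modulo the elements of [A] comes from a
sequence of integers converging modulo every integer, not only modulo [A]. *)
Lemma lift_residues (A : set posnat) (r : posnat -> int) : cd_set A ->
  (forall d e : posnat, A d -> A e -> (e %| d)%N -> r d ≡ r e [e]) ->
  exists x : nat -> posnat,
    (forall n, (x n.+1)%:zp ≡ (x n)%:zp [pfact n]) /\
    (forall n d, A d -> (d %| n`!)%N -> (x n)%:zp ≡ r d [d]).
Proof.
move=> cdA rr.
pose good n (y : posnat) :=
  forall d, A d -> (d %| n`!)%N -> y%:zp ≡ r d [d].
have step (p : nat * posnat) : exists y : posnat, good p.1 p.2 ->
    y%:zp ≡ p.2%:zp [pfact p.1] /\ good p.1.+1 y.
  case: p => n y /=; have [gy|] := pselect (good n y); last by exists pone.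
  have [g [Ag gn gmax]] := cd_set_greatest_divisor (pfact n.+1) cdA.
  (* The two constraints on the next term [z], modulo [n!] and modulo [g], are
     compatible because [h], as a divisor of [n!] in [A], is one of the moduli
     for which [y] already has the prescribed residue. *)
  have h0 : (0 < gcdn n`! g)%N by rewrite gcdn_gt0 fact_gt0.
  pose h := PosNat h0.
  have hg : (h %| g)%N by exact: dvdn_gcdr.
  have hn : (h %| n`!)%N by exact: dvdn_gcdl.
  have Ah : A h by case: cdA => _ + _; apply; [exact: Ag|].
  have yg : y%:zp ≡ r g [h].
    by apply: (@eqmod_trans _ (r h)); [exact: gy|apply: eqmod_sym; exact: rr].
  have [z [zy zg]] := @posnat_chinese (pfact n) g _ _ yg.
  exists z => _; split=> // d Ad dn.
  have dg := gmax d Ad dn.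
  by apply: (@eqmod_trans _ (r g)); [exact: eqmod_dvd dg _|exact: rr].
have [F HF] := choice step.
pose x := fix x n := if n is m.+1 then F (m, x m) else pone.
have gx n : good n (x n).
  elim: n => [d _|n IH]; last by have [] := HF (n, x n) IH.
  by rewrite dvdn1 => /eqP d1; rewrite d1 dvd1z.
by exists x; split=> [n|]; [have [] := HF (n, x n) (gx n)|].
Qed.

(** * Convergence for the polyadic norm in terms of congruences *)

Section Congruences.
Context (R : realType) (A : set posnat) (B : nat -> posnat).
Variables (infA : infinite_set A) (AB : cofinal_seq A B).
Local Notation PN := (polyadic_nat R infA AB).
Local Notation Om := (generalized_polyadic R infA AB).
Local Notation cls a := ((\pi_(completion PN) a)%qT : Om).

Lemma cofinal_near (d : posnat) : A d -> \forall n \near \oo, (d %| B n)%N.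
Proof. by move=> /AB.2[N hN]; exists N.+1. Qed.

(** The term of index [n] in the series of the norm is zero or [2 ^ -n]. *)
Lemma polyadic_norm_lt_dvd n p : (0 < n)%N ->
  polyadic_norm R B p < (2 ^+ n)^-1 -> ((B n)%:zp %| p)%Z.
Proof.
move=> n0; have := @polyadic_norm_ge_term R B p n n0.
rewrite /polyadic_h; case: ifP => // _; rewrite mul1r => /le_lt_trans h /h.
by rewrite ltxx.
Qed.

Lemma cauchy_residue (u : nat -> PN) : cauchy (u @ \oo) ->
  forall d : posnat, A d -> exists r : int, \forall k \near \oo, (u k)%:zp ≡ r [d].
Proof.
move=> /cauchy_seqE uc d /AB.2[n hn].
have e0 : 0 < (2 ^+ n.+1)^-1 :> R by rewrite invr_gt0 exprn_gt0.
have [N hN] := uc _ e0.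
exists (u N)%:zp; exists N => // k /= Nk.
apply: (@eqmod_dvd (B n.+1)); first exact: hn.
by apply: polyadic_norm_lt_dvd => //; exact: hN.
Qed.

(** A norm less than [e] only requires divisibility by finitely many [B n], the
remaining terms of the series being dominated by a geometric tail. *)
Lemma residue_cauchy (u : nat -> PN) :
  (forall d : posnat, A d -> exists r : int, \forall k \near \oo, (u k)%:zp ≡ r [d]) ->
  cauchy (u @ \oo).
Proof.
move=> ur; apply/cauchy_seqE => e e0.
have [m hm] : exists m, (2 ^+ m)^-1 < e.
  have /cvgrPdist_lt/(_ e e0)[m _ hm] : (fun n => (2^-1 : R) ^+ n) @ \oo --> (0 : R).
    by apply: cvg_expr; rewrite ger0_norm ?invr_ge0// invf_lt1// ltr1n.
  by exists m; have := hm m (leqnn m); rewrite sub0r normrN ger0_norm ?exprVn//.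
have [K hK] : exists K, forall k l, (K <= k)%N -> (K <= l)%N ->
    forall n, (0 < n <= m)%N -> (u k)%:zp ≡ (u l)%:zp [B n].
  elim: m {hm} => [|m [K1 h1]]; first by exists 0%N => k l _ _ [].
  have [r [K2 _ h2]] := ur _ (AB.1 m.+1 isT).
  exists (maxn K1 K2) => k l; rewrite !geq_max => /andP[k1 k2] /andP[l1 l2] n.
  move=> /andP[n0]; rewrite leq_eqVlt => /predU1P[->|nm].
    by apply: (@eqmod_trans _ r); [exact: h2|apply: eqmod_sym; exact: h2].
  by apply: h1 => //; rewrite n0.
exists K => k l Kk Kl; apply: le_lt_trans hm.
by apply: polyadic_norm_tail => n nm; rewrite /polyadic_h hK.
Qed.

Lemma polyadic_cls_eqP (a b : cauchy_seq PN) : cls a = cls b <->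
  forall d : posnat, A d -> \forall k \near \oo, (a k)%:zp ≡ (b k)%:zp [d].
Proof.
split=> [/completion_eqP/asboolP/cvgrPdist_lt ab d /AB.2[n hn]|ab].
  have e0 : 0 < (2 ^+ n.+1)^-1 :> R by rewrite invr_gt0 exprn_gt0.
  near=> k; apply: (@eqmod_dvd (B n.+1)); first exact: hn.
  apply: polyadic_norm_lt_dvd => //.
  have : `|0 - mdist (a k) (b k)| < (2 ^+ n.+1)^-1 by near: k; exact: ab.
  by rewrite sub0r normrN; exact: le_lt_trans (ler_norm _).
apply: polyadic_cls_eq => n n0.
by have [K _ hK] := ab _ (AB.1 n n0); exists K.
Unshelve. all: by end_near. Qed.

(** The zero of the completion is the limit of [B], whose terms are eventually
divisible by each [d] in [A]. *)
Lemma polyadic_cls_eq0 (a : cauchy_seq PN) : cls a = 0 <->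
  forall d : posnat, A d -> \forall k \near \oo, (d %| (a k : posnat))%N.
Proof.
have E (d : posnat) (p q : nat) : (d %| q)%N -> (p%:Z ≡ q%:Z [d]) = (d %| p)%N.
  by move=> dq; rewrite rpredBr//.
split=> [/polyadic_cls_eqP a0 d Ad|a0]; last apply/polyadic_cls_eqP => d Ad.
  apply: filterS2 (a0 d Ad) (cofinal_near Ad) => k /= h1 h2.
  by rewrite -(E d _ _ h2).
by apply: filterS2 (a0 d Ad) (cofinal_near Ad) => k /= h1 h2; rewrite E.
Qed.

End Congruences.

(** * From polyadic integers to generalized polyadic integers *)

Section Restriction.
Context (R : realType) (A : set posnat) (B : nat -> posnat).
Variables (infA : infinite_set A) (AB : cofinal_seq A B).
Local Notation PN := (polyadic_nat R infA AB).
Local Notation Om := (generalized_polyadic R infA AB).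
Local Notation cls a := ((\pi_(completion PN) a)%qT : Om).
Local Notation ZN := (polyadic_nat R infinite_posnat cofinal_fact).
Local Notation Z := (polyadic_integers R).
Local Notation clsZ a := ((\pi_(completion ZN) a)%qT : Z).

Lemma restrict_cauchy (a : cauchy_seq ZN) :
  `[< cauchy ((a : nat -> PN) @ \oo) >].
Proof.
apply/asboolP; apply: residue_cauchy => d _.
exact: (cauchy_residue (cauchy_valP a)).
Qed.

Definition restrict_seq (a : cauchy_seq ZN) : cauchy_seq PN :=
  CauchySeq (restrict_cauchy a).

Definition polyadic_restrict (x : Z) : Om :=
  cls (restrict_seq (repr (x : completion ZN))%qT).

Lemma polyadic_restrictE (a : cauchy_seq ZN) :
  polyadic_restrict (clsZ a) = cls (restrict_seq a).
Proof.
apply/polyadic_cls_eqP => d _.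
have /polyadic_cls_eqP : clsZ (repr (clsZ a : completion ZN))%qT = clsZ a.
  exact: reprK.
exact.
Qed.

Lemma polyadic_restrict_nmod : nmod_morphism polyadic_restrict.
Proof.
split=> [|].
  rewrite polyadic_restrictE; apply/polyadic_cls_eq0 => d Ad.
  exact: (cofinal_near cofinal_fact).
elim/cls_ind=> a; elim/cls_ind=> b.
rewrite [X in polyadic_restrict X]polyadic_addE !polyadic_restrictE [RHS]polyadic_addE.
exact: polyadic_cls_ext.
Qed.

Lemma polyadic_restrict_monoid : monoid_morphism polyadic_restrict.
Proof.
split=> [|].
  by rewrite polyadic_restrictE; exact: polyadic_cls_ext.
elim/cls_ind=> a; elim/cls_ind=> b.
rewrite [X in polyadic_restrict X]polyadic_mulE !polyadic_restrictE [RHS]polyadic_mulE.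
exact: polyadic_cls_ext.
Qed.

HB.instance Definition _ :=
  GRing.isNmodMorphism.Build Z Om polyadic_restrict polyadic_restrict_nmod.
HB.instance Definition _ :=
  GRing.isMonoidMorphism.Build Z Om polyadic_restrict polyadic_restrict_monoid.

(** The residues of a Cauchy sequence for [||.||_A] modulo the elements of [A]
are compatible, hence lift to a polyadic integer. *)
Lemma polyadic_restrict_surj (cdA : cd_set A) (y : Om) :
  exists x, polyadic_restrict x = y.
Proof.
elim/cls_ind: y => a.
have /choice[r hr] : forall d : posnat, exists r : int,
    A d -> \forall k \near \oo, (a k)%:zp ≡ r [d].
  move=> d; have [Ad|] := pselect (A d); last by exists 0.
  by have [r] := cauchy_residue (cauchy_valP a) Ad; exists r.
have rr (d e : posnat) : A d -> A e -> (e %| d)%N -> r d ≡ r e [e].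
  move=> Ad Ae ed; have [k [h1 h2]] := filter_ex (filterI (hr d Ad) (hr e Ae)).
  by apply: eqmod_trans h2; apply: eqmod_sym; exact: eqmod_dvd h1.
have [x [xS xr]] := lift_residues cdA rr.
have xfact n k : (n <= k)%N -> (x k)%:zp ≡ (x n)%:zp [pfact n].
  elim: k => [|k IH]; first by rewrite leqn0 => /eqP->; rewrite subrr.
  rewrite leq_eqVlt => /predU1P[->|]; first by rewrite subrr.
  rewrite ltnS => nk; apply: eqmod_trans (IH nk); apply: eqmod_dvd (xS k).
  by rewrite /= (fact_split nk) dvdn_mulr.
have dfact (d : posnat) k : (d <= k)%N -> (d %| k`!)%N.
  by move=> dk; rewrite dvdn_fact// posnat_gt0.
have xc : `[< cauchy ((x : nat -> ZN) @ \oo) >].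
  apply/asboolP; apply: residue_cauchy => d _; exists (x d)%:zp.
  exists (d : nat) => // k /= dk; apply: eqmod_dvd (xfact _ _ dk).
  exact: dfact.
exists (clsZ (CauchySeq xc)); rewrite polyadic_restrictE.
apply/polyadic_cls_eqP => d Ad.
near=> k; apply: (@eqmod_trans _ (r d)).
  by apply: xr => //; apply: dfact; near: k; exists (d : nat).
by apply: eqmod_sym; near: k; exact: hr.
Unshelve. all: by end_near. Qed.

(** The quotients [a k / m] form a Cauchy sequence because the residue of [a k]
modulo [m d] determines that of [a k / m] modulo [d]. *)
Lemma principal_ideal_polyadicP (m : posnat) (a : cauchy_seq ZN) :
  principal_ideal (to_polyadic_integers R m) (clsZ a) <->
  \forall k \near \oo, (m %| (a k : posnat))%N.
Proof.
split=> [[w _]|[K _ hK]].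
  elim/cls_ind: w => w; rewrite [LHS]polyadic_mulE => /polyadic_cls_eqP.
  move=> /(_ m I); apply: filterS => k /= /dvdzP[c h].
  have: (m%:zp %| (a k)%:zp)%Z.
    apply/dvdzP; exists ((w k)%:zp - c).
    by rewrite mulrBl -h PoszM; ring.
  by [].
(* Only the terms of index at least [K] are known to be multiples of [m]; the
   quotient sequence is therefore shifted by [K]. *)
have v_gt0 k : (0 < (a (k + K)%N : posnat) %/ m)%N.
  by rewrite divn_gt0 ?posnat_gt0// dvdn_leq ?posnat_gt0// hK//= leq_addl.
pose v k := PosNat (v_gt0 k).
have vE k : (a (k + K)%N)%:zp = m%:zp * (v k)%:zp.
  by rewrite -PoszM mulnC /= divnK// hK//= leq_addl.
have vc : `[< cauchy ((v : nat -> ZN) @ \oo) >].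
  apply/asboolP; apply: residue_cauchy => d _.
  have [r [N _ hN]] := cauchy_residue (cauchy_valP a) (I : [set: posnat] (pmul m d)).
  exists (v N)%:zp; exists N => // k /= Nk.
  have : (a (k + K)%N)%:zp ≡ (a (N + K)%N)%:zp [pmul m d].
    apply: (@eqmod_trans _ r); last apply: eqmod_sym.
      by apply: hN => /=; rewrite (leq_trans Nk) ?leq_addr.
    by apply: hN => /=; rewrite leq_addr.
  by rewrite !vE -mulrBr PoszM dvdz_mul2l// gt_eqF// ltz_nat posnat_gt0.
exists (clsZ (CauchySeq vc)) => //.
rewrite [LHS]polyadic_mulE; apply/polyadic_cls_eqP => d _.
have [r [N _ hN]] := cauchy_residue (cauchy_valP a) (I : [set: posnat] d).
exists N => // k /= Nk; rewrite PoszM -vE.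
apply: (@eqmod_trans _ r); last apply: eqmod_sym.
  by apply: hN => /=; rewrite (leq_trans Nk) ?leq_addr.
exact: hN.
Qed.

Lemma polyadic_restrict_eq0 (x : Z) : polyadic_restrict x = 0 <->
  (\bigcap_(a in A) principal_ideal (to_polyadic_integers R a)) x.
Proof.
elim/cls_ind: x => a; rewrite polyadic_restrictE polyadic_cls_eq0.
by split=> h d Ad; apply/principal_ideal_polyadicP; exact: h.
Qed.

End Restriction.

Theorem theorem3 (R : realType) (A : set posnat) (B : nat -> posnat)
    (cdA : cd_set A) (infA : infinite_set A) (AB : cofinal_seq A B)
    (alpha : polyadic_integers R)
    (halpha : \bigcap_(a in A) principal_ideal (to_polyadic_integers R a) =
              principal_ideal alpha) :
  exists f : {rmorphism generalized_polyadic R infA AB -> factor_ring alpha},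
    bijective f.
Proof.
apply: (@factor_ring_iso _ _ _ (polyadic_restrict infA AB)).
  exact: polyadic_restrict_surj.
by move=> x; rewrite polyadic_restrict_eq0 halpha.
Qed.
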